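(* Let $G$ be a triangle-free graph with $n_G$ vertices such that $\lambda_{\min}(S(G\,\dot\cup\,2K_2))\geqslant-5$, and assume $\alpha(G)\leqslant26$. For a vertex $x$ of $G$ let $a_x$ be its valency in $G$. Then: (i) $n_G\leqslant68$; (ii) if $n_G\geqslant66$, then there exists an edge $xy$ of $G$ with $a_x+a_y\leqslant20$.
   Context: All graphs are finite, simple, undirected. For a graph $H$, $S(H)=\mathbf{J}-\mathbf{I}-2A(H)$ is its Seidel matrix ($A(H)$ adjacency matrix, $\mathbf{J}$ all-ones matrix), and $\lambda_{\min}$ denotes the smallest eigenvalue. $G\,\dot\cup\,2K_2$ is the disjoint union of $G$ with two copies of $K_2$. $\alpha(G)$ is the independence number. *)

(* Defs.v *)
From mathcomp Require Import all_boot all_order all_algebra.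
From mathcomp Require Import polyrcf reals.
Set Implicit Arguments.
Unset Strict Implicit.
Unset Printing Implicit Defensive.
Import Order.TTheory GRing.Theory Num.Theory.
Local Open Scope ring_scope.

Record sgraph := SGraph {
  vertex :> finType;
  adj : rel vertex;
  adj_sym : symmetric adj;
  adj_irr : irreflexive adj }.

Section DisjointUnion.
Variables G H : sgraph.

Definition du_rel (x y : (G + H)%type) : bool :=
  match x, y with
  | inl a, inl b => adj a b
  | inr a, inr b => adj a b
  | _, _ => false
  end.

Lemma du_sym : symmetric du_rel.
Proof. by move=> [a|a] [b|b] //=; exact: adj_sym. Qed.

Lemma du_irr : irreflexive du_rel.
Proof. by move=> [a|a] /=; exact: adj_irr. Qed.

Definition disjoint_union : sgraph := SGraph du_sym du_irr.

End DisjointUnion.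

Section Complete.
Variable n : nat.

Definition complete_rel (i j : 'I_n) : bool := i != j.

Lemma complete_sym : symmetric complete_rel.
Proof. by move=> i j; rewrite /complete_rel eq_sym. Qed.

Lemma complete_irr : irreflexive complete_rel.
Proof. by move=> i; rewrite /complete_rel eqxx. Qed.

Definition complete_graph : sgraph := SGraph complete_sym complete_irr.

End Complete.

Definition two_K2 : sgraph :=
  disjoint_union (complete_graph 2) (complete_graph 2).

Definition valency (G : sgraph) (x : G) : nat := #|[set y | adj x y]|.

Definition triangle_free (G : sgraph) : Prop :=
  forall x y z : G, ~~ [&& adj x y, adj y z & adj z x].

Definition independent (G : sgraph) (A : {set G}) : bool :=
  [forall x in A, forall y in A, ~~ adj x y].

Definition independence_number (G : sgraph) : nat :=
  \max_(A : {set G} | independent A) #|A|.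

Definition adjacency (R : realType) (H : sgraph) : 'M[R]_#|H| :=
  \matrix_(i, j) (adj (enum_val i) (enum_val j))%:R.

Definition seidel (R : realType) (H : sgraph) : 'M[R]_#|H| :=
  const_mx 1 - 1%:M - 2 *: adjacency R H.

(* [rootsR p] lists the real roots of [p] in increasing order; the default 0
   is returned only when there is no real eigenvalue, which does not happen
   for a nonempty symmetric matrix. *)
Definition lambda_min (R : realType) (n : nat) (M : 'M[R]_n) : R :=
  head 0 (rootsR (char_poly M)).

Lemma mem_rootsR_char_poly (R : realType) n (M : 'M[R]_n) (a : R) :
  (a \in rootsR (char_poly M)) = eigenvalue M a.
Proof.
have p0 : char_poly M != 0 by rewrite monic_neq0 ?char_poly_monic.
by rewrite -(roots_on_rootsR p0) in_itv /= eigenvalue_root_char.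
Qed.

Lemma lambda_min_le (R : realType) n (M : 'M[R]_n) (a : R) :
  eigenvalue M a -> lambda_min M <= a.
Proof.
rewrite -mem_rootsR_char_poly /lambda_min.
have : sorted <%R (rootsR (char_poly M)) by exact: sorted_roots.
case: rootsR => [//|b s] /= /(order_path_min lt_trans)/allP lb.
by rewrite inE => /predU1P[->//|/lb/ltW].
Qed.

Lemma lambda_min_eigenvalue (R : realType) n (M : 'M[R]_n) (a : R) :
  eigenvalue M a -> eigenvalue M (lambda_min M).
Proof.
rewrite -!mem_rootsR_char_poly /lambda_min.
by case: rootsR => [//|b s] _; rewrite mem_head.
Qed.

(* Main.v *)
Require Import Defs.
From mathcomp Require Import all_boot all_order all_algebra.
From mathcomp Require Import reals complex spectral.
From mathcomp Require Import ring lra zify.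
Set Implicit Arguments.
Unset Strict Implicit.
Unset Printing Implicit Defensive.
Import Order.TTheory GRing.Theory Num.Theory.
Local Open Scope ring_scope.

(** Giving weight [- s / 6] to the four vertices of 2K_2, where [s] is the sum of
    [u] over [G], turns the eigenvalue hypothesis into
    [Q(u) = 2 |u|^2 - u^T A u + s^2 / 6 >= 0] for every real [u] on [G].
    A weighted star bounds all valencies by 13. Let [a] be the maximum valency,
    attained at [x]. For [6 <= a <= 12], adding [Q] over all pairs of neighbours
    of [x] to [Q] of one more vector gives an inequality whose terms in the
    vertices far from [x] depend only on local counts; suitable weights bound the
    number of vertices, by 68 if [a <= 10] and by 65 if [a] is 11 or 12. For
    [a = 13] the star is a null vector of [Q], so every vertex far from [x] has
    exactly three common neighbours with [x]; hence there are at most 66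
    vertices, and 66 would force a strongly regular graph with a nonintegral
    multiplicity. For [a <= 5], two nonadjacent parts of [G] cannot both have
    nonpositive [2 |u|^2 - u^T A u] unless both are degenerate; so, apart from
    few vertices near one branching vertex, [G] consists of pieces whose
    independence ratio is at least 2/5, and the bound on the independence number
    concludes. *)

(** * Positive semidefiniteness from the spectrum, and the Seidel form *)

(** [M] is unitarily diagonalised over [R[i]]. The diagonal entries are real and are roots of the
    characteristic polynomial of [M], hence eigenvalues over [R]; the form is then a sum of
    nonnegative multiples of squared moduli. *)
Lemma psd_of_eigenvalue_ge0 (R : rcfType) n (M : 'M[R]_n) (v : 'rV[R]_n) :
  M^T = M -> (forall a, eigenvalue M a -> 0 <= a) ->
  0 <= (v *m M *m v^T) 0 0.
Proof.
move=> symM eigM; pose f : {rmorphism R -> R[i]} := real_complex R.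
pose A := map_mx f M.
have herA : A \is hermsymmx.
  apply: realsym_hermsym; last first.
    by apply/mxOverP => i j; rewrite mxE complex_real.
  apply/is_hermitianmxP; rewrite expr0 scale1r map_mx_id //.
  by rewrite /A map_trmx symM.
have /orthomx_spectralP AE := hermitian_normalmx herA.
set P := spectralmx A in AE; set sp := spectral_diag A in AE.
have Pu : P \in unitmx by exact: spectral_unit.
have sp_ge0 j : 0 <= sp 0 j.
  have : sp 0 j \is Num.real by have /mxOverP := hermitian_spectral_diag_real herA; apply.
  move=> /complex_realP[c spE].
  rewrite spE ler0c; apply: eigM; rewrite eigenvalue_root_char.
  rewrite -(fmorph_root f) map_char_poly.
  rewrite [X in root _ X](_ : _ = sp 0 j); last by rewrite spE.
  rewrite -eigenvalue_root_char.
  apply/eigenvalueP; exists (row j P); last first.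
    apply/eqP => /(congr1 (mulmx^~ (invmx P))) /=.
    rewrite -row_mul mulmxV // mul0mx => /rowP/(_ j).
    by rewrite !mxE eqxx => /eqP; rewrite oner_eq0.
  have PA : P *m A = diag_mx sp *m P by rewrite {1}AE !mulmxA mulmxV // mul1mx.
  by rewrite -row_mul PA; apply/rowP => k; rewrite mxE mul_diag_mx !mxE.
pose w := map_mx f v *m invmx P.
have : 0 <= (w *m diag_mx sp *m (map_mx Num.conj w)^T) 0 0.
  rewrite mxE; apply: sumr_ge0 => j _.
  rewrite mul_mx_diag !mxE mulrAC -[X in X * _]mulr1.
  by rewrite mulr1 mulr_ge0 // mul_conjC_ge0.
suff -> : w *m diag_mx sp *m (map_mx Num.conj w)^T = map_mx f (v *m M *m v^T).
  by rewrite mxE ler0c.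
rewrite /w !map_mxM /= -/A {1}AE trmx_mul -!mulmxA; congr (_ *m (_ *m (_ *m _))).
rewrite invmx_unitary ?spectral_unitarymx // map_mxCK trmxK -map_trmx.
by congr (_ *m _); apply/matrixP => i j; rewrite !mxE conj_Creal // complex_real.
Qed.

(** Since S + 5I = J + 4I - 2A, the rank-one, diagonal and adjacency parts separate. *)
Lemma seidel_form (R : realType) (H : sgraph) (w : H -> R) :
  (\row_i w (enum_val i) *m (seidel R H + 5%:M) *m (\row_i w (enum_val i))^T) 0 0
  = (\sum_x w x) ^+ 2 + 4 * (\sum_x w x ^+ 2)
    - 2 * \sum_x \sum_y (adj x y)%:R * w x * w y.
Proof.
have E (F : H -> R) : \sum_x F x = \sum_(i < #|H|) F (enum_val i).
  by rewrite (big_enum_val (A := H)).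
rewrite mxE; transitivity (\sum_x (w x * (\sum_y w y) + 4 * w x ^+ 2
   - 2 * \sum_y (adj x y)%:R * w x * w y)); last first.
  by rewrite sumrB big_split /= -!mulr_sumr -mulr_suml expr2.
rewrite [RHS]E.
apply: eq_bigr => i _; rewrite !mxE mulr_suml.
rewrite (E w) (E (fun y => (adj (enum_val i) y)%:R * w (enum_val i) * w y)) !mulr_sumr.
have -> : 4 * w (enum_val i) ^+ 2 =
   \sum_(j < #|H|) (i == j)%:R * (4 * w (enum_val i) * w (enum_val j)).
  rewrite (bigD1 i) //= eqxx mul1r big1 ?addr0 ?expr2 ?mulrA // => j ji.
  by rewrite eq_sym (negbTE ji) mul0r.
rewrite -big_split -sumrB /=; apply: eq_bigr => j _.
rewrite !mxE (adj_sym (enum_val j)) [j == i]eq_sym.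
by case: (i == j); case: adj; ring.
Qed.

(** * The form Q on [G] and its null vectors *)

Section Form.
Variables (R : realType) (G : sgraph).
Implicit Types f g : G -> R.

(** The entry at [x] of (2I - A + J/6) f, that is, half the gradient of Q at [f]. *)
Definition qform_grad f x : R :=
  2 * f x - \sum_y (adj x y)%:R * f y + (\sum_y f y) / 6.

Definition qform f g : R := \sum_x f x * qform_grad g x.

Lemma qformE f g : qform f g = 2 * (\sum_x f x * g x)
  - \sum_x \sum_y (adj x y)%:R * f x * g y + (\sum_x f x) * (\sum_x g x) / 6.
Proof.
rewrite -mulrA mulr_suml mulr_sumr -sumrB -big_split /=.
apply: eq_bigr => x _; rewrite /qform_grad mulrDr mulrBr mulrCA mulr_sumr.
by congr (_ - _ + _); apply: eq_bigr => y _; rewrite mulrCA mulrA.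
Qed.

Lemma qformC f g : qform f g = qform g f.
Proof.
rewrite !qformE [(\sum_x f x) * _]mulrC; congr (_ - _ + _).
  by congr (_ * _); apply: eq_bigr => x _; rewrite mulrC.
rewrite exchange_big /=; apply: eq_bigr => x _; apply: eq_bigr => y _.
by rewrite adj_sym mulrAC.
Qed.

Lemma qformDl a f b g h :
  qform (fun z => a * f z + b * g z) h = a * qform f h + b * qform g h.
Proof.
rewrite /qform !mulr_sumr -big_split /=.
by apply: eq_bigr => x _; rewrite mulrDl !mulrA.
Qed.

Lemma qform_combine a f b g :
  qform (fun z => a * f z + b * g z) (fun z => a * f z + b * g z) =
  a ^+ 2 * qform f f + 2 * a * b * qform f g + b ^+ 2 * qform g g.
Proof.
by rewrite qformDl [qform f _]qformC [qform g _]qformC !qformDl [qform g f]qformC; ring.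
Qed.

Hypothesis lamG : -5 <= lambda_min (seidel R (disjoint_union G two_K2)).

Lemma qform_ge0 f : 0 <= qform f f.
Proof.
pose H := disjoint_union G two_K2.
(* With weight t on the vertices of 2K_2, the terms of the Seidel form in s and t are s^2 + 8st +
   24t^2. They are smallest at t = -s/6, with value s^2/3, and the whole form is then 2 Q(f). *)
pose t := - (\sum_x f x) / 6.
pose w (z : H) : R := match z with inl a => f a | inr _ => t end.
have psdM : 0 <= (\row_i w (enum_val i) *m (seidel R H + 5%:M) *m (\row_i w (enum_val i))^T) 0 0.
  apply: psd_of_eigenvalue_ge0.
    by apply/matrixP => i j; rewrite !mxE adj_sym [j == i]eq_sym.
  move=> a /eigenvalueP[v vM v0].
  have : eigenvalue (seidel R H) (a - 5).
    apply/eigenvalueP; exists v => //.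
    by rewrite scalerBl -vM [in RHS]mulmxDr mul_mx_scalar addrK.
  by move/lambda_min_le; move: lamG; lra.
move: psdM; rewrite seidel_form.
have -> : \sum_(x : H) w x = \sum_x f x + 4 * t.
  rewrite big_sumType /=; congr (_ + _).
  by rewrite big_sumType /= !big_ord_recl !big_ord0; ring.
have -> : \sum_(x : H) w x ^+ 2 = \sum_x f x * f x + 4 * t ^+ 2.
  rewrite big_sumType /=; congr (_ + _).
  by rewrite big_sumType /= !big_ord_recl !big_ord0; ring.
have -> : \sum_(x : H) \sum_(y : H) (adj x y)%:R * w x * w y =
   \sum_x \sum_y (adj x y)%:R * f x * f y + 4 * t ^+ 2.
  rewrite big_sumType /=; congr (_ + _).
    apply: eq_bigr => x _; rewrite big_sumType /= [X in _ + X]big1 ?addr0 //.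
    by move=> i _; rewrite !mul0r.
  rewrite big_sumType /= !big_ord_recl !big_ord0 !big_sumType /=.
  rewrite !big_ord_recl !big_ord0 /= !big1; try by move=> i _; rewrite !mul0r.
  rewrite /complete_rel /=; ring.
by rewrite qformE /t; lra.
Qed.

(* Expand the sum over [y] of [Q(|N| u_y - U) >= 0]. *)
Lemma qform_jensen (N : {set G}) (u : G -> G -> R) (U : G -> R) :
  (forall z, U z = \sum_(y in N) u y z) ->
  qform U U <= #|N|%:R * \sum_(y in N) qform (u y) (u y).
Proof.
move=> UE; have [N0 | N0] := posnP #|N|.
  rewrite N0 mul0r /qform big1 // => x _.
  by rewrite UE big1 ?mul0r // => y; rewrite (cards0_eq N0) inE.
pose a : R := #|N|%:R; have a0 : 0 < a by rewrite ltr0n.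
have : 0 <= \sum_(y in N) qform (fun z => a * u y z + -1 * U z) (fun z => a * u y z + -1 * U z).
  by apply: sumr_ge0 => y _; exact: qform_ge0.
under eq_bigr do rewrite qform_combine.
rewrite !big_split /= -!mulr_sumr sumr_const -/a.
have -> : \sum_(y in N) qform (u y) U = qform U U.
  rewrite /qform exchange_big; apply: eq_bigr => x _ /=.
  by rewrite -mulr_suml -UE.
rewrite -mulr_natr -/a => H; rewrite -subr_ge0 -(pmulr_rge0 _ a0).
by apply: le_trans H _; rewrite le_eqVlt; apply/orP; left; apply/eqP; ring.
Qed.

(** A null vector of a positive semidefinite form lies in its radical: otherwise a small move along
    the unit vector [e] at [x] would make the form negative. *)
Lemma qform_null f x : qform f f = 0 -> qform_grad f x = 0.
Proof.
move=> f0; pose e z : R := (z == x)%:R.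
have ge : qform e f = qform_grad f x.
  rewrite /qform (bigD1 x) //= /e eqxx mul1r big1 ?addr0 // => z /negbTE ->.
  by rewrite mul0r.
set c := qform e e; have c0 : 0 <= c := qform_ge0 e.
(* The denominator is positive even when [c = 0], and at f + t e the form takes the value -t^2 (c +
   2). *)
pose t := - qform_grad f x / (c + 1).
have := qform_ge0 (fun z => 1 * f z + t * e z).
rewrite qform_combine f0 qformC ge -/c mulr0 add0r mulr1 => H.
have c1 : c + 1 != 0 by rewrite gt_eqF // ltr_wpDl.
have tE : qform_grad f x = - t * (c + 1) by rewrite /t; field.
have {}H : 0 <= - (t ^+ 2 * (c + 2)).
  by apply: le_trans H _; rewrite tE le_eqVlt; apply/orP; left; apply/eqP; ring.
suff t0 : t = 0 by rewrite tE t0 oppr0 mul0r.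
apply/eqP; rewrite -sqrf_eq0 eq_le sqr_ge0 andbT.
by rewrite -(ler_pM2r (x := c + 2)) ?mul0r -?oppr_ge0 // ltr_wpDl.
Qed.

End Form.

(** * The form on a vertex, some of its neighbours, and vertices far from it *)

Section Star.
Variables (R : realType) (G : sgraph).
Implicit Types (x y z : G) (N W : {set G}) (h F : G -> R).

Definition nbhd x : {set G} := [set y | adj x y].

Definition star_vec x N W (c d : R) h z : R :=
  c * (z == x)%:R + d * (z \in N)%:R + (z \in W)%:R * h z.

Definition adj_count N z : R := \sum_(y in N) (adj z y)%:R.

Lemma adj_countE N z : adj_count N z = #|nbhd z :&: N|%:R.
Proof.
rewrite /adj_count -natr_sum; congr _%:R.
rewrite big_mkcond -sum1_card [RHS]big_mkcond; apply: eq_bigr => y _.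
by rewrite !inE andbC; case: (y \in N); case: adj.
Qed.

Lemma sum_indicator N F : \sum_z (z \in N)%:R * F z = \sum_(z in N) F z.
Proof.
rewrite [RHS]big_mkcond; apply: eq_bigr => z _.
by case: (z \in N); rewrite ?mul1r ?mul0r.
Qed.

Lemma sum_star_vec x N W c d h F :
  \sum_z star_vec x N W c d h z * F z =
  c * F x + d * (\sum_(z in N) F z) + \sum_(z in W) h z * F z.
Proof.
rewrite -!sum_indicator mulr_sumr.
have -> : c * F x = \sum_z c * ((z == x)%:R * F z).
  rewrite (bigD1 x) //= eqxx mul1r big1 ?addr0 // => z /negbTE ->.
  by rewrite mul0r mulr0.
by rewrite -!big_split; apply: eq_bigr => z _; rewrite /star_vec /=; ring.
Qed.

Hypothesis tfG : triangle_free G.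

Lemma nbhd_nonadj x y z : adj x y -> adj x z -> adj y z = false.
Proof.
move=> xy xz; apply/negbTE/negP => yz.
by have := tfG x y z; rewrite xy yz adj_sym xz.
Qed.

(** As [G] is triangle-free, [N] spans no edge, and [W] has no neighbour of [x]; so the only edges
    that contribute run between [x] and [N], between [N] and [W], and inside [W]. *)
Lemma qform_star_vec x N W c d h :
  {in N, forall y, adj x y} -> {in W, forall z, [&& z != x, z \notin N & ~~ adj x z]} ->
  let f := star_vec x N W c d h in
  qform f f = 2 * c ^+ 2 + 2 * #|N|%:R * d ^+ 2 + 2 * (\sum_(z in W) h z ^+ 2)
   - 2 * #|N|%:R * c * d - 2 * d * (\sum_(z in W) h z * adj_count N z)
   - \sum_(z in W) \sum_(y in W) (adj z y)%:R * h z * h y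
   + (c + #|N|%:R * d + \sum_(z in W) h z) ^+ 2 / 6.
Proof.
move=> xN xW f.
have fx : f x = c.
  rewrite /f /star_vec eqxx; case: (boolP (x \in N)) => [/xN|_]; first by rewrite adj_irr.
  by case: (boolP (x \in W)) => [/xW|_]; rewrite ?eqxx //= mulr1 mulr0 mul0r !addr0.
have fN z : z \in N -> f z = d.
  move=> zN; rewrite /f /star_vec zN; case: eqP => [zx|_].
    by move/xN: zN; rewrite zx adj_irr.
  by case: (boolP (z \in W)) => [/xW|_]; rewrite ?zN /= ?andbF //= mulr0 mulr1 mul0r addr0 add0r.
have fW z : z \in W -> f z = h z.
  move=> zW; have /and3P[/negbTE zx /negbTE zN _] := xW z zW.
  by rewrite /f /star_vec zx zN zW /= !mulr0 mul1r !add0r.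
have cN : \sum_(z in N) (adj x z)%:R = #|N|%:R :> R.
  by rewrite -sum1_card natr_sum; apply: eq_bigr => z /xN ->.
have cW : \sum_(z in W) h z * (adj x z)%:R = 0.
  by apply: big1 => z /xW/and3P[_ _ /negbTE ->]; rewrite mulr0.
have adjf z : \sum_y (adj z y)%:R * f y =
   c * (adj z x)%:R + d * adj_count N z + \sum_(y in W) h y * (adj z y)%:R.
  by rewrite -sum_star_vec; apply: eq_bigr => y _; rewrite mulrC.
rewrite qformE.
have -> : \sum_z \sum_y (adj z y)%:R * f z * f y =
    \sum_z f z * \sum_y (adj z y)%:R * f y.
  by apply: eq_bigr => z _; rewrite mulr_sumr; apply: eq_bigr => y _; ring.
have -> : \sum_z f z = c + #|N|%:R * d + \sum_(z in W) h z.
  transitivity (\sum_z f z * 1); first by apply: eq_bigr => z; rewrite mulr1.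
  rewrite sum_star_vec sumr_const mulr1 [d * _]mulrC.
  by congr (_ + _); apply: eq_bigr => z; rewrite mulr1.
rewrite !sum_star_vec fx !adjf adj_irr (eq_bigr _ fN) sumr_const.
rewrite (eq_bigr (fun z => h z ^+ 2)); last by move=> z zW; rewrite fW // expr2.
rewrite [adj_count N x]cN cW.
have -> : \sum_(z in N) \sum_y (adj z y)%:R * f y =
    #|N|%:R * c + \sum_(z in W) h z * adj_count N z.
  transitivity (\sum_(z in N) (c + \sum_(y in W) h y * (adj z y)%:R)).
    apply: eq_bigr => z zN; rewrite adjf [adj z x]adj_sym xN // mulr1.
    rewrite [adj_count N z]big1 ?mulr0 ?addr0 // => y yN.
    by rewrite (nbhd_nonadj (xN _ zN) (xN _ yN)).
  rewrite big_split /= sumr_const mulr_natl exchange_big /=; congr (_ + _).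
  apply: eq_bigr => z _; rewrite -mulr_sumr.
  by congr (_ * _); apply: eq_bigr => y _; rewrite adj_sym.
have -> : \sum_(z in W) h z * (\sum_y (adj z y)%:R * f y) =
    d * (\sum_(z in W) h z * adj_count N z) +
    \sum_(z in W) \sum_(y in W) (adj z y)%:R * h z * h y.
  rewrite mulr_sumr -big_split; apply: eq_bigr => z zW /=.
  rewrite adjf adj_sym; have /and3P[_ _ /negbTE ->] := xW z zW.
  rewrite mulr0 add0r mulrDr mulrCA mulr_sumr; congr (_ + _).
  by apply: eq_bigr => y _; ring.
by rewrite mulr0 -[d *+ _]mulr_natl; field.
Qed.

End Star.

(** * A local inequality around a vertex *)

Section Certificate.
Variables (R : realType) (G : sgraph).
Implicit Types (x y z : G) (N W : {set G}) (h F : G -> R).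
Hypothesis tfG : triangle_free G.
Hypothesis lamG : -5 <= lambda_min (seidel R (disjoint_union G two_K2)).

Lemma valencyE x : valency x = #|nbhd x|.
Proof. by []. Qed.

Lemma qform_star x N (p : R) : {in N, forall y, adj x y} ->
  let f := star_vec x N set0 p 1 (fun=> 0) in
  qform f f = 2 * p ^+ 2 + 2 * #|N|%:R - 2 * #|N|%:R * p + (p + #|N|%:R) ^+ 2 / 6.
Proof.
move=> xN f; rewrite /f qform_star_vec //; last by move=> z; rewrite inE.
by rewrite !big_set0; field.
Qed.

Section Bound.
Variables (x : G) (W : {set G}) (p tau mu C : R).
Hypothesis xW : {in W, forall z, (z != x) && ~~ adj x z}.
Let a : R := (valency x)%:R.
Let r : R := #|W|%:R.
Let s0 := tau + a * mu + C * r.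
Let k := adj_count R (nbhd x).
Let g := adj_count R W.

(* The sum of [qform_jensen] for the vectors [p e_y + 1_(N(y) \cap W)], with [y]
   in [N(x)], and of [qform_ge0] for [tau] at [x], [mu] on [N(x)], [C - k] on
   [W]: the squares of [\sum_W k] cancel, leaving a sum over [W]. *)
Lemma local_inequality (d : nat) : {in nbhd x, forall y, (#|nbhd y :&: W| <= d)%N} ->
  0 <= 2 * a * (a - 1) * p ^+ 2 + 2 * tau ^+ 2 + 2 * a * mu ^+ 2 - 2 * a * tau * mu
    + 2 * C ^+ 2 * r + s0 ^+ 2 / 6
    + \sum_(z in W) ((2 * a - 2 * p * a + a * d%:R / 6 - 4 * C - 2 * mu * C - s0 / 3) * k z
        + (2 * p + 2 * mu) * k z ^+ 2 + C * (2 * k z - C) * g z).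
Proof.
move=> Wd; set N := nbhd x in Wd *.
have xN : {in N, forall y, adj x y} by move=> y; rewrite inE.
have xNW : {in W, forall z, [&& z != x, z \notin N & ~~ adj x z]}.
  by move=> z /xW/andP[-> xz]; rewrite inE xz.
pose b y : R := #|nbhd y :&: W|%:R.
have sumb : \sum_(y in N) b y = \sum_(z in W) k z.
  rewrite exchange_big /=; apply: eq_bigr => y _; rewrite /b -adj_countE.
  by apply: eq_bigr => z _; rewrite adj_sym.
have sumb2 : \sum_(y in N) b y ^+ 2 <= d%:R * \sum_(y in N) b y.
  rewrite mulr_sumr; apply: ler_sum => y yN.
  by rewrite expr2 ler_wpM2r ?ler0n // ler_nat Wd.
pose u y := star_vec y (nbhd y :&: W) set0 p 1 (fun=> 0).
pose U := star_vec x N W 0 p k.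
have UE z : U z = \sum_(y in N) u y z.
  rewrite /U /u /star_vec !big_split /= mul0r add0r [X in _ = _ + X]big1 ?addr0; last first.
    by move=> y _; rewrite inE mul0r.
  rewrite -!mulr_sumr mul1r; congr (_ * _ + _).
    have [zN | zN] := boolP (z \in N).
      rewrite (bigD1 z) //= eqxx big1 ?addr0 // => y /andP[_ /negbTE].
      by rewrite eq_sym => ->.
    rewrite big1 // => y yN; case: eqP => // zy.
    by move: zN; rewrite zy yN.
  rewrite /k /adj_count mulr_sumr; apply: eq_bigr => y _.
  by rewrite !inE adj_sym; case: (z \in W); case: adj; rewrite ?mulr1 ?mulr0.
have := qform_jensen lamG UE.
have -> : \sum_(y in N) qform (u y) (u y) = 2 * a * p ^+ 2
    + 2 * (1 - p) * (\sum_(y in N) b y) + (a * p ^+ 2 + 2 * p * (\sum_(y in N) b y)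
       + \sum_(y in N) b y ^+ 2) / 6.
  transitivity (\sum_(y in N) (2 * p ^+ 2 + p ^+ 2 / 6 +
      (2 * (1 - p) + p / 3) * b y + b y ^+ 2 / 6)).
    apply: eq_bigr => y yN; rewrite qform_star; last by move=> z; rewrite !inE => /andP[].
    by rewrite -/(b y); field.
  rewrite big_split big_split /= sumr_const -mulr_sumr -mulr_suml -[_ *+ _]mulr_natl.
  by rewrite -/a; field.
have := qform_ge0 lamG (star_vec x N W tau mu (fun z => C - k z)).
rewrite !qform_star_vec // -/a.
set D1 := \sum_(z in W) \sum_(y in W) _; set D2 := \sum_(z in W) \sum_(y in W) _.
(* The products [k z * k y] over edges inside [W] cancel between the weights [C - k] and [k]. What
   remains is linear in [k] along edges, so by symmetry it needs only the degrees [g]. *)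
have DE : D1 - D2 = \sum_(z in W) (C ^+ 2 - 2 * C * k z) * g z.
  rewrite /D1 /D2 -sumrB.
  transitivity (\sum_(z in W) \sum_(y in W)
     (adj z y)%:R * (C ^+ 2 - C * k z) - \sum_(z in W) \sum_(y in W) (adj z y)%:R * (C * k y)).
    rewrite -sumrB; apply: eq_bigr => z _; rewrite -!sumrB.
    by apply: eq_bigr => y _; ring.
  rewrite [X in _ - X]exchange_big -sumrB /=; apply: eq_bigr => z _.
  rewrite -!mulr_suml /g /adj_count.
  under [X in _ - X * _]eq_bigr do rewrite adj_sym.
  by ring.
pose K := \sum_(z in W) k z; pose K2 := \sum_(z in W) k z ^+ 2.
have e1 : \sum_(z in W) (C - k z) = r * C - K.
  by rewrite sumrB sumr_const -[C *+ _]mulr_natl.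
have e2 : \sum_(z in W) (C - k z) ^+ 2 = r * C ^+ 2 - 2 * C * K + K2.
  transitivity (\sum_(z in W) (C ^+ 2 - 2 * C * k z + k z ^+ 2)).
    by apply: eq_bigr => z _; ring.
  by rewrite big_split sumrB sumr_const -mulr_sumr -[_ *+ _]mulr_natl.
have e3 : \sum_(z in W) (C - k z) * adj_count R N z = C * K - K2.
  rewrite mulr_sumr -sumrB; apply: eq_bigr => z _.
  by rewrite -/(k z); ring.
have e4 : \sum_(z in W) k z * adj_count R N z = K2.
  by apply: eq_bigr => z _; rewrite expr2.
rewrite e1 e2 e3 e4 sumb -/K -/K2.
have -> : \sum_(z in W) ((2 * a - 2 * p * a + a * d%:R / 6 - 4 * C - 2 * mu * C - s0 / 3) * k z
        + (2 * p + 2 * mu) * k z ^+ 2 + C * (2 * k z - C) * g z) =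
   (2 * a - 2 * p * a + a * d%:R / 6 - 4 * C - 2 * mu * C - s0 / 3) * K
   + (2 * p + 2 * mu) * K2 - (D1 - D2).
  rewrite DE !mulr_sumr -big_split -sumrB /=; apply: eq_bigr => z _; ring.
rewrite sumb -/K in sumb2.
have {}sumb2 : a * (\sum_(y in N) b y ^+ 2) <= a * (d%:R * K).
  by rewrite ler_wpM2l ?ler0n.
rewrite -/K2 => Q1 Q2; rewrite -subr_ge0 in Q2.
(* The third nonnegative term trades the sum of [b y ^+ 2] for [d%:R * K]. *)
apply: le_trans (addr_ge0 (addr_ge0 Q1 Q2) (_ : 0 <= (a * (d%:R * K) - a * (\sum_(y in N) b y ^+ 2)) / 6)) _.
  by rewrite divr_ge0 // subr_ge0.
by rewrite le_eqVlt; apply/orP; left; apply/eqP; rewrite /s0; field.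
Qed.

End Bound.
End Certificate.

(** * Bounding valencies and the number of vertices by explicit weights *)

Lemma exists_subset_card (T : finType) (S : {set T}) (r : nat) :
  (r <= #|S|)%N -> exists2 W : {set T}, W \subset S & #|W| = r.
Proof.
move=> rS; exists [set z in take r (enum S)].
  by apply/subsetP => z; rewrite inE => /mem_take; rewrite mem_enum.
by rewrite cardsE (card_uniqP _) ?take_uniq ?enum_uniq // size_takel // -cardE.
Qed.

Section Certificates.
Variables (R : realType) (G : sgraph).
Implicit Types (x y z : G) (N W : {set G}) (h F : G -> R).
Hypothesis tfG : triangle_free G.
Hypothesis lamG : -5 <= lambda_min (seidel R (disjoint_union G two_K2)).

Lemma valency_le13 x : (valency x <= 13)%N.
Proof.
set a := valency x; have [->//|a_gt0] := posnP a.
have xN : {in nbhd x, forall y, adj x y} by move=> y; rewrite inE.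
(* With unit weight on the [a] leaves, the central weight 5a/13 minimises the form; the minimum is
   (2/13) a (13 - a). *)
have := qform_ge0 lamG (star_vec x (nbhd x) set0 (5 / 13 * a%:R) 1 (fun=> 0)).
rewrite (qform_star tfG) // -/(valency x) -/a.
have -> : 2 * (5 / 13 * a%:R) ^+ 2 + 2 * a%:R - 2 * a%:R * (5 / 13 * a%:R) +
  (5 / 13 * a%:R + a%:R) ^+ 2 / 6 = a%:R * (2 / 13 * (13 - a%:R)) :> R by field.
rewrite pmulr_rge0 ?ltr0n // -(ler_nat R) => H; lra.
Qed.

(** If there were more vertices, [local_inequality] would apply to [r] of those far from [x]. Each
    term is at most [c0 + eta * k z], where [n] and [m] stand for the numbers of neighbours in N(x)
    and in [W]. The multiplier [eta] pays for the bound a(a - 1) on the number of edges between N(x)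
    and [W]. *)
Lemma certificate (a r : nat) (p tau mu C eta c0 : R) x :
  valency x = a -> (forall z, valency z <= a)%N ->
  0 <= eta ->
  let s0 := tau + a%:R * mu + C * r%:R in
  (forall n m, (n + m <= a)%N ->
    (2 * a%:R - 2 * p * a%:R + a%:R * a.-1%:R / 6 - 4 * C - 2 * mu * C - s0 / 3) * n%:R
    + (2 * p + 2 * mu) * n%:R ^+ 2 + C * (2 * n%:R - C) * m%:R <= c0 + eta * n%:R) ->
  2 * a%:R * (a%:R - 1) * p ^+ 2 + 2 * tau ^+ 2 + 2 * a%:R * mu ^+ 2
    - 2 * a%:R * tau * mu + 2 * C ^+ 2 * r%:R + s0 ^+ 2 / 6
    + c0 * r%:R + eta * (a%:R * a.-1%:R) < 0 ->
  (#|G| <= a + r)%N.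
Proof.
move=> ax amax eta0 s0 phi; rewrite ltNge leqNgt; apply: contra => ar.
(* The closed neighbourhood has [a + 1] vertices, so more than [a + r] vertices in all leave at
   least [r] outside it. *)
have [W WS Wr] : exists2 W : {set G}, W \subset ~: (x |: nbhd x) & #|W| = r.
  apply: exists_subset_card.
  have := cardsC (x |: nbhd x); rewrite cardsU1 inE adj_irr -/(valency x) ax.
  by move: ar; rewrite -cardsT; lia.
have xW : {in W, forall z, (z != x) && ~~ adj x z}.
  by move=> z /(subsetP WS); rewrite !inE negb_or.
have Wd : {in nbhd x, forall y, (#|nbhd y :&: W| <= a.-1)%N}.
  move=> y; rewrite inE => xy; have /subset_leq_card : nbhd y :&: W \subset nbhd y :\ x.
    by apply/subsetP => z; rewrite !inE => /andP[-> /xW/andP[->]].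
  move/leq_trans; apply; have := cardsD1 x (nbhd y); rewrite inE adj_sym xy.
  by move: (amax y); rewrite valencyE; lia.
have := local_inequality tfG lamG p tau mu C xW Wd.
rewrite ax Wr -/s0 => H; apply: (le_trans H).
rewrite -[X in _ <= X]addrA lerD2l.
have : \sum_(z in W) adj_count R (nbhd x) z <= a%:R * a.-1%:R.
  rewrite exchange_big /=.
  apply: le_trans (_ : \sum_(y in nbhd x) a.-1%:R <= _); last first.
    by rewrite sumr_const -ax valencyE mulr_natl.
  apply: ler_sum => y yN; apply: le_trans (_ : #|nbhd y :&: W|%:R <= _); last first.
    by rewrite ler_nat Wd.
  by rewrite -adj_countE; apply: ler_sum => z _; rewrite adj_sym.
move/(ler_wpM2l eta0) => K_le; apply: le_trans (lerD (lexx (c0 * r%:R)) K_le).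
rewrite -Wr [c0 * _]mulr_natr -sumr_const mulr_sumr -big_split /=; apply: ler_sum => z _.
rewrite !adj_countE; apply: phi.
have := cardsUI (nbhd z :&: nbhd x) (nbhd z :&: W).
rewrite (_ : (nbhd z :&: nbhd x) :&: (nbhd z :&: W) = set0) ?cards0 ?addn0; last first.
  by apply/setP => y; rewrite !inE; apply/negP => /and3P[/andP[_ xy] _ /xW]; rewrite xy andbF.
move=> <-; apply: leq_trans (amax z); apply: subset_leq_card.
by rewrite -setIUr subsetIl.
Qed.

End Certificates.

(** * Maximum valency from 6 to 12 *)

Section MaximumValency.
Variables (R : realType) (G : sgraph).
Hypothesis tfG : triangle_free G.
Hypothesis lamG : -5 <= lambda_min (seidel R (disjoint_union G two_K2)).

(** For each numeral [n] the inequality is affine in [m], so the bounds 0 <= m <= a - n suffice.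
    Thirteen splits reach n = 12, the largest [a] in use. *)
Local Ltac check_certificate :=
  let n := fresh "n" in let m := fresh "m" in let nm := fresh "nm" in
  move=> n m nm; have := ler0n R m;
  lazymatch type of nm with
  | is_true (_ <= ?a)%N =>
    have : (m%:R <= a%:R - n%:R :> R) by rewrite lerBrDl -natrD ler_nat
  end;
  move: nm; do 13?[case: n => [|n] /=]; move=> nm; try (exfalso; lia); lra.

(* The rational weights below were found by numerical convex optimization. *)
Lemma card_valency6 (x : G) : valency x = 6%N -> (forall z : G, valency z <= 6)%N ->
  (#|G| <= 6 + 62)%N.
Proof.
move=> ax amax.
apply: (certificate tfG lamG (p := 7/3) (tau := -27) (mu := -10) (C := 4/3)
  (eta := 8/9) (c0 := 0) ax amax) => /=; [lra | | lra].
check_certificate.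
Qed.

Lemma card_valency7 (x : G) : valency x = 7%N -> (forall z : G, valency z <= 7)%N ->
  (#|G| <= 7 + 61)%N.
Proof.
move=> ax amax.
apply: (certificate tfG lamG (p := 3) (tau := -43) (mu := -14) (C := 2)
  (eta := 34/3) (c0 := 0) ax amax) => /=; [lra | | lra].
check_certificate.
Qed.

Lemma card_valency8 (x : G) : valency x = 8%N -> (forall z : G, valency z <= 8)%N ->
  (#|G| <= 8 + 60)%N.
Proof.
move=> ax amax.
apply: (certificate tfG lamG (p := 3) (tau := -42) (mu := -13) (C := 2)
  (eta := 10) (c0 := 0) ax amax) => /=; [lra | | lra].
check_certificate.
Qed.

Lemma card_valency9 (x : G) : valency x = 9%N -> (forall z : G, valency z <= 9)%N ->
  (#|G| <= 9 + 59)%N.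
Proof.
move=> ax amax.
apply: (certificate tfG lamG (p := 4) (tau := -53) (mu := -15) (C := 2)
  (eta := 0) (c0 := 34/3) ax amax) => /=; [lra | | lra].
check_certificate.
Qed.

Lemma card_valency10 (x : G) : valency x = 10%N -> (forall z : G, valency z <= 10)%N ->
  (#|G| <= 10 + 58)%N.
Proof.
move=> ax amax.
apply: (certificate tfG lamG (p := 4) (tau := -113) (mu := -27) (C := 4)
  (eta := 202/3) (c0 := 92) ax amax) => /=; [lra | | lra].
check_certificate.
Qed.

(** For maximum valency 11 and 12 the bound is 65 instead of 68: part (ii) requires these valencies
    to be impossible as soon as there are 66 vertices. *)
Lemma card_valency11 (x : G) : valency x = 11%N -> (forall z : G, valency z <= 11)%N ->
  (#|G| <= 11 + 54)%N.
Proof.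
move=> ax amax.
apply: (certificate tfG lamG (p := 4) (tau := -95) (mu := -21) (C := 4)
  (eta := 35) (c0 := 76) ax amax) => /=; [lra | | lra].
check_certificate.
Qed.

Lemma card_valency12 (x : G) : valency x = 12%N -> (forall z : G, valency z <= 12)%N ->
  (#|G| <= 12 + 53)%N.
Proof.
move=> ax amax.
apply: (certificate tfG lamG (p := 5) (tau := -112) (mu := -24) (C := 4)
  (eta := 140/3) (c0 := 84) ax amax) => /=; [lra | | lra].
check_certificate.
Qed.

End MaximumValency.

(** * Valency 13 *)

(** In a rank factorisation B = C D, cancelling [C] on the left and [D] on the right of B B = a B
    gives D C = a I, of size the rank; and B and D C have the same trace. *)
Lemma mxtrace_scaled_idempotent (F : fieldType) n (B : 'M[F]_n) (a : F) :
  B *m B = a *: B -> \tr B = a * (\rank B)%:R.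
Proof.
move=> BB; have := mulmx_base B.
move: (col_base_full B) (row_base_free B).
move: (col_base B) (row_base B) => C D fC fD CD.
have [C' C'C] := row_fullP fC; have [D' DD'] := row_freeP fD.
have /(congr1 (fun X => C' *m X *m D')) : C *m (D *m C) *m D = a *: (C *m D).
  by rewrite mulmxA CD -mulmxA CD.
rewrite /= -scalemxAr -scalemxAl !mulmxA C'C !mul1mx.
rewrite -!mulmxA DD' mulmx1 scalemx1 => DC.
by rewrite -[in LHS]CD mxtrace_mulC DC mxtrace_scalar mulr_natr.
Qed.

Section Valency13.
Variables (R : realType) (G : sgraph).
Implicit Types x y z : G.
Hypothesis tfG : triangle_free G.
Hypothesis lamG : -5 <= lambda_min (seidel R (disjoint_union G two_K2)).

(* The star with weights 5 at [x] and 1 on [N(x)] is a null vector of [qform]. *)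
Lemma valency13_common x z : valency x = 13%N -> z != x -> ~~ adj x z ->
  #|nbhd z :&: nbhd x| = 3%N.
Proof.
move=> x13 zx xz; pose f := star_vec x (nbhd x) set0 (5 : R) 1 (fun=> 0).
have xN : {in nbhd x, forall y, adj x y} by move=> y; rewrite inE.
have f0 : qform f f = 0 by rewrite (qform_star tfG) // -valencyE x13; lra.
have := qform_null lamG z f0; rewrite /qform_grad.
have -> : f z = 0 by rewrite /f /star_vec (negbTE zx) !inE (negbTE xz) !mulr0 !addr0.
have -> : \sum_y (adj z y)%:R * f y = adj_count R (nbhd x) z.
  transitivity (\sum_y f y * (adj z y)%:R); first by apply: eq_bigr => y _; rewrite mulrC.
  rewrite sum_star_vec big_set0 adj_sym (negbTE xz) -/(adj_count _ _ _).
  by rewrite mulr0 add0r mul1r addr0.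
have -> : \sum_y f y = 18.
  transitivity (\sum_y f y * 1); first by apply: eq_bigr => y _; rewrite mulr1.
  by rewrite sum_star_vec big_set0 sumr_const -valencyE x13 /=; lra.
rewrite adj_countE => H.
have {H} : (#|nbhd z :&: nbhd x|%:R : R) = 3%:R by lra.
by move/eqP; rewrite eqr_nat => /eqP.
Qed.

(** Both sides count the edges leaving N(x) away from [x]; without triangles none of them stays
    inside N(x). *)
Lemma sum_common_nbhd x :
  (\sum_(z in ~: (x |: nbhd x)) #|nbhd z :&: nbhd x| =
   \sum_(y in nbhd x) (valency y).-1)%N.
Proof.
have E (A B : {set G}) : #|A :&: B| = (\sum_(y in B) (y \in A))%N.
  rewrite -sum1_card big_mkcond [RHS]big_mkcond; apply: eq_bigr => y _.
  by rewrite inE andbC; case: (y \in B); case: (y \in A).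
under eq_bigr do rewrite E.
rewrite exchange_big /=; apply: eq_bigr => y; rewrite inE => xy.
have -> : (valency y).-1 = #|nbhd y :\ x|.
  by rewrite valencyE (cardsD1 x (nbhd y)) inE adj_sym xy.
have -> : nbhd y :\ x = nbhd y :&: ~: (x |: nbhd x).
  apply/setP => z; rewrite !inE negb_or [LHS]andbC.
  case: (boolP (adj y z)) => //= yz.
  by rewrite (@nbhd_nonadj _ tfG y x z) ?andbT // adj_sym.
by rewrite E; apply: eq_bigr => z _; rewrite !inE adj_sym.
Qed.

(** The n - 14 vertices far from [x] each send three edges to N(x), and each of the 13 neighbours of
    [x] receives at most 12: 3 (n - 14) <= 156. *)
Lemma valency13_card x : valency x = 13%N -> (#|G| <= 66)%N.
Proof.
move=> x13; have := sum_common_nbhd x.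
rewrite (eq_bigr (fun=> 3%N)); last first.
  by move=> z; rewrite !inE negb_or => /andP[]; exact: valency13_common.
rewrite sum_nat_const => S.
have : (\sum_(y in nbhd x) (valency y).-1 <= \sum_(y in nbhd x) 12)%N.
  by apply: leq_sum => y _; have := valency_le13 tfG lamG y; lia.
rewrite -S sum_nat_const -valencyE x13.
have := cardsC (x |: nbhd x); rewrite cardsU1 inE adj_irr -valencyE x13.
rewrite -cardsT; lia.
Qed.

(** For n = 66 the same count is tight, 3 * 52 = 13 * 12, so no neighbour of [x] can fall short. *)
Lemma valency13_nbhd x y : #|G| = 66%N -> valency x = 13%N -> adj x y -> valency y = 13%N.
Proof.
move=> n66 x13 xy; have := sum_common_nbhd x.
rewrite (eq_bigr (fun=> 3%N)); last first.
  by move=> z; rewrite !inE negb_or => /andP[]; exact: valency13_common.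
rewrite sum_nat_const (bigD1 y) ?inE //= => S.
have : (\sum_(z in nbhd x | z != y) (valency z).-1 <= \sum_(z in nbhd x | z != y) 12)%N.
  by apply: leq_sum => z _; have := valency_le13 tfG lamG z; lia.
rewrite sum_nat_const.
have -> : #|[pred z in nbhd x | z != y]| = 12%N.
  have := cardsD1 y (nbhd x); rewrite inE xy -valencyE x13 => card_xy.
  rewrite (_ : #|_| = #|nbhd x :\ y|); first by lia.
  by apply: eq_card => z; rewrite !inE andbC.
have := cardsC (x |: nbhd x); rewrite cardsU1 inE adj_irr -valencyE x13 n66.
have := valency_le13 tfG lamG y; lia.
Qed.

(** A vertex far from [x] has a common neighbour with it, so valency 13 spreads from [x] in at most
    two steps. *)
Lemma valency13_regular x z : #|G| = 66%N -> valency x = 13%N -> valency z = 13%N.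
Proof.
move=> n66 x13; have [->//|zx] := eqVneq z x.
have [|xz] := boolP (adj x z); first exact: valency13_nbhd.
have : (0 < #|nbhd z :&: nbhd x|)%N by rewrite valency13_common.
case/card_gt0P => y; rewrite !inE adj_sym => /andP[yz xy].
by apply: valency13_nbhd yz => //; exact: valency13_nbhd xy.
Qed.

(* [G] would be strongly regular with parameters (66, 13, 0, 3), and its
   eigenvalue 2 would have multiplicity 312 / 7. *)
Lemma valency13_card_ne66 x : valency x = 13%N -> #|G| != 66%N.
Proof.
move=> x13; apply/eqP => n66.
have reg z : valency z = 13%N by exact: valency13_regular x13.
pose A := adjacency R G; pose c : R := - (3 / 11).
have E (F : G -> R) : \sum_(k < #|G|) F (enum_val k) = \sum_y F y.
  by rewrite [RHS](big_enum_val (A := G)).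
have rowA i : \sum_j A i j = 13.
  rewrite (eq_bigr (fun j => (adj (enum_val i) (enum_val j))%:R)); last by move=> j _; rewrite mxE.
  rewrite (E (fun y => (adj (enum_val i) y)%:R)) -natr_sum.
  transitivity ((valency (enum_val i))%:R : R); last by rewrite reg.
  by congr _%:R; rewrite valencyE -sum1_card [RHS]big_mkcond; apply: eq_bigr => y _; rewrite !inE; case: adj.
have symA i j : A i j = A j i by rewrite !mxE adj_sym.
have AA i j : \sum_k A i k * A k j = 10 * (i == j)%:R + 3 - 3 * A i j.
  transitivity (#|nbhd (enum_val i) :&: nbhd (enum_val j)|%:R : R).
    transitivity (\sum_(y : G) (adj (enum_val i) y && adj (enum_val j) y)%:R : R).
      rewrite -E; apply: eq_bigr => k _.
      by rewrite !mxE -natrM mulnb [adj _ (enum_val j)]adj_sym.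
    rewrite -natr_sum -sum1_card; congr _%:R.
    by rewrite [RHS]big_mkcond; apply: eq_bigr => y _; rewrite !inE; case: andP.
  rewrite mxE; have [<-|ij] := eqVneq i j.
    by rewrite setIid -valencyE reg adj_irr mulr1 mulr0; lra.
  have [aij|nij] := boolP (adj (enum_val i) (enum_val j)).
    rewrite (_ : _ :&: _ = set0) ?cards0 ?mulr0 ?mulr1; first by lra.
    by apply/setP => y; rewrite !inE; apply/negP => /andP[/(nbhd_nonadj tfG aij) ->].
  rewrite valency13_common ?reg 1?adj_sym //; first by rewrite !mulr0; lra.
  by apply: contra ij => /eqP/enum_val_inj ->.
have n66R : (#|G|%:R : R) = 66 by rewrite n66.
(* By [AA], A has eigenvalues 2 and -5 off the constants and 13 on them. A + 5I kills the eigenvalue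
   -5, and [c] kills the constants, as 18 - 66 * 3/11 = 0; so [B] is 7 times the projection onto the
   eigenspace of 2. *)
pose B : 'M[R]_#|G| := \matrix_(i, j) (A i j + 5 * (i == j)%:R + c).
have BB : B *m B = 7 *: B.
  apply/matrixP => i j; rewrite !mxE.
  transitivity (\sum_k (A i k * A k j + c * A i k + c * A k j + c ^+ 2 +
     (i == k)%:R * (5 * A k j + 5 * c) + (k == j)%:R * (5 * A i k + 5 * c + 25 * (i == k)%:R))).
    by apply: eq_bigr => k _; rewrite !mxE; ring.
  rewrite !big_split /= AA -!mulr_sumr rowA.
  rewrite (eq_bigr (fun k => A j k) (fun k _ => symA k j)) rowA sumr_const card_ord.
  rewrite (bigD1 i) //= eqxx big1; last by move=> k; rewrite eq_sym => /negbTE ->; rewrite mul0r.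
  rewrite (bigD1 j) //= eqxx big1; last by move=> k /negbTE ->; rewrite mul0r.
  by rewrite mxE (_ : true%:R = 1) // -[c *+ _]mulr_natr n66R /c; field.
have := mxtrace_scaled_idempotent BB.
rewrite /mxtrace (eq_bigr (fun=> 5 + c)); last by move=> i _; rewrite !mxE eqxx adj_irr /= mulr1 add0r.
rewrite sumr_const card_ord -[_ *+ _]mulr_natr n66R => trB.
have /eqP : (312%:R : R) = (7 * \rank B)%N%:R by rewrite natrM -trB /c; field.
by rewrite eqr_nat => /eqP; lia.
Qed.

End Valency13.

(** * Independent sets and peeling *)

Section Independence.
Variable G : sgraph.
Implicit Types (x y z : G) (I J W : {set G}).
Local Open Scope nat_scope.

Lemma independentP I :
  reflect {in I &, forall y z, ~~ adj y z} (independent I).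
Proof.
apply: (iffP forall_inP) => [indI y z yI zI | indI y yI].
  by move/forall_inP: (indI y yI); apply.
by apply/forall_inP => z zI; exact: indI.
Qed.

Lemma independent0 : independent (set0 : {set G}).
Proof. by apply/independentP => y z; rewrite inE. Qed.

Lemma independent1 x : independent [set x].
Proof. by apply/independentP => y z /set1P-> /set1P->; rewrite adj_irr. Qed.

Lemma independentU I J : independent I -> independent J ->
  {in I & J, forall y z, ~~ adj y z} -> independent (I :|: J).
Proof.
move=> /independentP indI /independentP indJ IJ; apply/independentP => y z.
case/setUP => yI; case/setUP => zI; [exact: indI | exact: IJ | | exact: indJ].
by rewrite adj_sym; exact: IJ.
Qed.

Lemma card_independent I : independent I -> #|I| <= independence_number G.
Proof. by move=> indI; rewrite /independence_number leq_bigmax_cond. Qed.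

Lemma card_remove_closed_nbhd x W : x \in W ->
  #|W| = #|W :\: (x |: nbhd x)| + (#|nbhd x :&: W|).+1.
Proof.
move=> xW; rewrite -(cardsID (x |: nbhd x) W) addnC; congr (_ + _).
rewrite setIUr (setIC W (nbhd x)) (setIidPr _) ?sub1set //.
by rewrite cardsU1 !inE adj_irr.
Qed.

Lemma independent_add x W I : x \in W -> I \subset W :\: (x |: nbhd x) ->
  independent I ->
  [/\ x |: I \subset W, independent (x |: I) & #|x |: I| = #|I|.+1].
Proof.
move=> xW IV indI; have IW := subsetP IV; split.
- by rewrite subUset sub1set xW (subset_trans IV) // subsetDl.
- rewrite independentU ?independent1 // => y z /set1P-> /IW.
  by rewrite !inE negb_or => /andP[/andP[]].
- by rewrite cardsU1 (_ : x \notin I) //; apply/negP => /IW; rewrite !inE eqxx.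
Qed.

Lemma peel W : exists I W',
  [/\ [/\ I \subset W, W' \subset W :\: I & independent I],
      {in I & W', forall y z, ~~ adj y z},
      {in W', forall z, 2 <= #|nbhd z :&: W'|} & #|W| <= 2 * #|I| + #|W'|].
Proof.
have [n] := ubnP #|W|; elim: n W => // n IHn W /ltnSE leWn.
have [minW | ] := boolP [forall z in W, 2 <= #|nbhd z :&: W|].
  exists set0, W; rewrite sub0set setD0 subxx independent0 cards0; split=> //.
    by move=> y z; rewrite inE.
  exact/forall_inP.
case/forall_inPn => x xW degx; have cW := card_remove_closed_nbhd xW.
have [|I [W' [[IV W'V indI] IW' minW' leV]]] := IHn (W :\: (x |: nbhd x)).
  by lia.
have [IW ind card] := independent_add xW IV indI.
exists (x |: I), W'; split=> //.
- split=> //; apply/subsetP => y yW'; have := subsetP W'V y yW'.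
  by rewrite !inE !negb_or => /andP[-> /andP[/andP[-> _] ->]].
- move=> y z; case/setU1P => [->|]; last exact: IW'.
  by move=> /(subsetP W'V); rewrite !inE negb_or => /and3P[_ /andP[]].
- by move: degx cW leV; rewrite card; clear; lia.
Qed.

Hypothesis tfG : triangle_free G.

Lemma independent_nbhdI x W : independent (nbhd x :&: W).
Proof.
apply/independentP => y z /setIP[xy _] /setIP[xz _]; rewrite !inE in xy xz.
by rewrite (nbhd_nonadj tfG xy xz).
Qed.

(* Deleting a closed neighbourhood costs at most three vertices, and in a
   triangle-free graph it leaves a vertex of degree at most one, whose closed
   neighbourhood has at most two. *)
Lemma independent_maxdeg2 W : {in W, forall z, #|nbhd z :&: W| <= 2} ->
  exists I, [/\ I \subset W, independent I & 2 * #|W| <= 5 * #|I|].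
Proof.
have [n] := ubnP #|W|; elim: n W => // n IHn W /ltnSE leWn degW.
have subdeg (V : {set G}) : V \subset W -> {in V, forall z, #|nbhd z :&: V| <= 2}.
  move=> VW z /(subsetP VW)/degW; apply: leq_trans.
  by rewrite subset_leq_card // setIS.
have [W0|[x xW]] := set_0Vmem W.
  by exists set0; rewrite sub0set independent0 W0 cards0.
have [deg2 | /forall_inPn[z zW]] := boolP [forall z in W, 1 < #|nbhd z :&: W|]; last first.
  rewrite -leqNgt => z1; have cW := card_remove_closed_nbhd zW.
  have [||I [IV indI leI]] := IHn (W :\: (z |: nbhd z)).
  - by lia.
  - by apply: subdeg; exact: subsetDl.
  have [sub ind card] := independent_add zW IV indI.
  by exists (z |: I); rewrite card; split=> //; lia.
have degx := degW x xW; have cW := card_remove_closed_nbhd xW.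
(* A vertex [v] at distance two from [x] loses their common neighbour [y] when the closed
   neighbourhood of [x] goes. Taking [x] and [v] costs at most 3 + 2 vertices. *)
have /card_gt0P[y /setIP[]] : 0 < #|nbhd x :&: W| by have := forall_inP deg2 x xW; lia.
rewrite inE => xy yW; have := forall_inP deg2 y yW.
rewrite (cardsD1 x) !inE adj_sym xy xW ltnS => /card_gt0P[v].
rewrite !inE => /and3P[vx yv vW].
set V := W :\: (x |: nbhd x) in cW.
have yx : adj y x by rewrite adj_sym.
have vV : v \in V by rewrite !inE negb_or vx vW (nbhd_nonadj tfG yx yv).
have cV := card_remove_closed_nbhd vV.
have degv : #|nbhd v :&: V| <= 1.
  rewrite -ltnS; apply: leq_trans (degW v vW); apply: proper_card; apply/properP.
  split; first by rewrite setIS // subsetDl.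
  by exists y; rewrite !inE ?xy ?orbT ?andbF // adj_sym yv.
have [||I [IV indI leI]] := IHn (V :\: (v |: nbhd v)).
- by lia.
- by apply: subdeg; exact: subset_trans (subsetDl _ _) (subsetDl _ _).
have [sub ind card] := independent_add vV IV indI.
have [sub' ind' card'] := independent_add xW sub ind.
exists (x |: (v |: I)); split=> //.
by move: cW cV degx degv leI; rewrite card' card; clear; lia.
Qed.

End Independence.

(** * Weights of total zero on two nonadjacent parts *)

Section Balance.
Variables (R : realType) (G : sgraph).
Implicit Types (x y z : G) (W : {set G}) (b : G -> nat).
Hypothesis lamG : -5 <= lambda_min (seidel R (disjoint_union G two_K2)).

Definition adj_sum b z : nat := (\sum_y adj z y * b y)%N.

(* Weighting [b] and [W] so that the total weight vanishes removes the rank-one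
   term of the form, so two nonadjacent parts with nonpositive remaining terms
   must both be degenerate. *)
Lemma balanced_degenerate b W :
  {in W, forall z, b z = 0%N} ->
  (forall y z, (0 < b y)%N -> z \in W -> ~~ adj y z) ->
  (2 * \sum_z b z * b z <= \sum_z b z * adj_sum b z)%N ->
  {in W, forall z, 2 <= #|nbhd z :&: W|}%N ->
  (0 < #|W|)%N -> (0 < \sum_z b z)%N ->
  [/\ (2 * \sum_z b z * b z = \sum_z b z * adj_sum b z)%N,
      {in W, forall z, #|nbhd z :&: W| = 2%N} &
      forall z, b z = 0%N -> z \notin W ->
        (#|W| * adj_sum b z = (\sum_z b z) * #|nbhd z :&: W|)%N].
Proof.
move=> bW adjbW leb degW W0 b0.
pose f z : R := (b z)%:R; pose g z : R := (z \in W)%:R.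
set B := (\sum_z b z * b z)%N in leb *; set M := (\sum_z b z * adj_sum b z)%N in leb *.
set s := (\sum_z b z)%N in b0 *; set w := #|W| in W0 *.
pose e := (\sum_(z in W) #|nbhd z :&: W|)%N.
have adjf z : \sum_y (adj z y)%:R * f y = (adj_sum b z)%:R.
  by rewrite natr_sum; apply: eq_bigr => y _; rewrite natrM.
have adjg z : \sum_y (adj z y)%:R * g y = #|nbhd z :&: W|%:R.
  rewrite -adj_countE /adj_count -sum_indicator.
  by apply: eq_bigr => y _; rewrite mulrC.
have sumf : \sum_z f z = s%:R by rewrite natr_sum.
have sumg : \sum_z g z = w%:R.
  transitivity (\sum_z (z \in W)%:R * (1 : R)); first by apply: eq_bigr => z; rewrite mulr1.
  by rewrite sum_indicator sumr_const.
have sum_adj (h1 h2 : G -> R) : \sum_z \sum_y (adj z y)%:R * h1 z * h2 y =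
    \sum_z h1 z * \sum_y (adj z y)%:R * h2 y.
  by apply: eq_bigr => z _; rewrite mulr_sumr; apply: eq_bigr => y _; ring.
have ff : qform f f = 2 * B%:R - M%:R + s%:R ^+ 2 / 6.
  rewrite qformE sum_adj sumf -expr2 !natr_sum.
  congr (2 * _ - _ + _); apply: eq_bigr => z _; first by rewrite natrM.
  by rewrite adjf natrM.
have fg : qform f g = s%:R * w%:R / 6.
  rewrite qformE sum_adj sumf sumg big1 ?big1 ?mulr0 ?subr0 ?add0r // => z _.
    rewrite adjg /f; have [-> | ] := posnP (b z); first by rewrite mul0r.
    move=> bz; rewrite (_ : _ :&: _ = set0) ?cards0 ?mulr0 //.
    by apply/setP => y; rewrite !inE; apply/negP => /andP[zy /(adjbW _ _ bz)]; rewrite zy.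
  by rewrite /f /g; case: (boolP (z \in W)) => [/bW->|]; rewrite ?mul0r ?mulr0.
have gg : qform g g = 2 * w%:R - e%:R + w%:R ^+ 2 / 6.
  rewrite qformE sum_adj sumg -expr2 !sum_indicator natr_sum.
  congr (2 * _ - _ + _); last by apply: eq_bigr => z _; rewrite adjg.
  rewrite (eq_bigr (fun=> 1)); first by rewrite sumr_const.
  by move=> z; rewrite /g => ->.
pose v z := w%:R * f z + (- s%:R) * g z.
have vv : qform v v = w%:R ^+ 2 * (2 * B%:R - M%:R) + s%:R ^+ 2 * (2 * w%:R - e%:R).
  by rewrite qform_combine ff fg gg; field.
have lee : (2 * w <= e)%N by rewrite mulnC -sum_nat_const; apply: leq_sum.
have w2 : 0 < w%:R ^+ 2 :> R by rewrite exprn_gt0 // ltr0n.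
have s2 : 0 < s%:R ^+ 2 :> R by rewrite exprn_gt0 // ltr0n.
have leb' : 2 * B%:R - M%:R <= 0 :> R by rewrite subr_le0 -natrM ler_nat.
have lee' : 2 * w%:R - e%:R <= 0 :> R by rewrite subr_le0 -natrM ler_nat.
have v0 := qform_ge0 lamG v; rewrite vv in v0.
have t1 : w%:R ^+ 2 * (2 * B%:R - M%:R) <= 0 :> R by rewrite pmulr_rle0.
have t2 : s%:R ^+ 2 * (2 * w%:R - e%:R) <= 0 :> R by rewrite pmulr_rle0.
(* The form at [v] is nonnegative and is the sum of the nonpositive terms in [t1] and [t2], so both
   vanish. *)
have z1 : 2 * B%:R - M%:R = 0 :> R.
  by apply/eqP; rewrite eq_le leb' -(pmulr_rge0 _ w2); lra.
have z2 : 2 * w%:R - e%:R = 0 :> R.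
  by apply/eqP; rewrite eq_le lee' -(pmulr_rge0 _ s2); lra.
have vv0 : qform v v = 0 by rewrite vv z1 z2 !mulr0 addr0.
split.
- by apply/eqP; rewrite -(eqr_nat R) natrM -subr_eq0 z1.
- have e2 : e = (2 * w)%N by apply/eqP; rewrite -(eqr_nat R) natrM eq_sym -subr_eq0 z2.
  move=> z zW; apply/eqP; rewrite eqn_leq degW // andbT.
  have : (2 * w = 2 + \sum_(y in W | y != z) 2)%N.
    by rewrite mulnC -sum_nat_const (bigD1 z).
  rewrite -e2 /e (bigD1 z) //= => E.
  have : (\sum_(y in W | y != z) 2 <= \sum_(y in W | y != z) #|nbhd y :&: W|)%N.
    by apply: leq_sum => y /andP[/degW].
  lia.
(* Outside both parts [v] is zero, and its total is zero, so the vanishing gradient says that the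
   neighbours of [z] have total weight zero. *)
- move=> z bz zW; have := qform_null lamG z vv0; rewrite /qform_grad.
  have -> : v z = 0 by rewrite /v /f /g bz (negbTE zW) !mulr0 addr0.
  have -> : \sum_y v y = 0 by rewrite big_split /= -!mulr_sumr sumf sumg; ring.
  have -> : \sum_y (adj z y)%:R * v y =
      w%:R * (adj_sum b z)%:R - s%:R * #|nbhd z :&: W|%:R.
    rewrite -adjf -adjg !mulr_sumr -sumrB.
    by apply: eq_bigr => y _; rewrite /v; ring.
  rewrite mulr0 mul0r addr0 sub0r => /eqP; rewrite oppr_eq0 subr_eq0 -!natrM eqr_nat.
  by move/eqP.
Qed.

End Balance.

(** * Counting vertices around a weighted core *)

Lemma leq_card_bigcup (T T' : finType) (A : {set T}) (F : T -> {set T'}) (d : nat) :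
  {in A, forall y, #|F y| <= d}%N -> (#|\bigcup_(y in A) F y| <= #|A| * d)%N.
Proof.
move=> Fd; rewrite -sum_nat_const.
elim/big_ind2: _ => [|m A1 n A2 leA leB|y /Fd //]; first by rewrite cards0.
by apply: leq_trans (leq_card_setU _ _) _; exact: leq_add.
Qed.

Section Core.
Variables (R : realType) (G : sgraph).
Implicit Types (x y z : G) (I N S W : {set G}) (b : G -> nat).
Hypothesis tfG : triangle_free G.
Hypothesis lamG : -5 <= lambda_min (seidel R (disjoint_union G two_K2)).
Hypothesis alphaG : (independence_number G <= 26)%N.
Local Open Scope nat_scope.

Lemma card_independentU I J : independent I -> independent J ->
  {in I & J, forall y z, (y != z) && ~~ adj y z} ->
  independent (I :|: J) /\ #|I :|: J| = #|I| + #|J|.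
Proof.
move=> indI indJ IJ; split.
  by apply: independentU => // y z yI zJ; have /andP[] := IJ y z yI zJ.
rewrite cardsU (_ : I :&: J = set0) ?cards0 ?subn0 //.
apply/setP => y; rewrite !inE; apply/negP => /andP[yI yJ].
by have := IJ y y yI yJ; rewrite eqxx.
Qed.

(** The vertices of [W0] outside [S] and its neighbours are peeled into [I1] and a rest [W'], to
    which [balanced_degenerate] applies together with [b]. The bounds 137 = 2 * 68 + 1 and 344 = 5 *
    68 + 4 are the largest that still give 68 in integers. *)
Lemma core_bound I0 W0 N S b (a t : nat) :
  independent I0 -> {in I0 & W0, forall y z, (y != z) && ~~ adj y z} ->
  #|G| <= 2 * #|I0| + #|W0| ->
  {in W0, forall z, #|nbhd z :&: W0| <= a} ->
  independent N -> #|N| = a -> 0 < a -> N \subset S -> S \subset W0 ->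
  (forall z, (z \in S) = (0 < b z)) ->
  2 * (\sum_z b z * b z) <= \sum_z b z * adj_sum b z ->
  #|S :|: [set z in W0 | [exists y in S, adj y z]]| <= t ->
  t + 2 * (26 - a) <= 68 ->
  (2 * (\sum_z b z * b z) = \sum_z b z * adj_sum b z ->
    2 * #|S| + 5 * (26 - a) <= 137 /\
    5 * t + 10 * (26 - a) + (\sum_z b z) * a.-1 <= 344) ->
  #|G| <= 68.
Proof.
move=> indI0 I0W0 nG degW0 indN Na a0 NS SW0 Sb leb.
set T := S :|: _ => Tt t68 eqb.
have [I1 [W' [[I1W W'W indI1] I1W' degW' cW]]] := peel (W0 :\: T).
have farT z : z \in W0 :\: T -> [/\ z \in W0, z \notin S & {in S, forall y, ~~ adj y z}].
  rewrite !inE negb_or => /andP[/andP[zS nz] zW]; split=> // y yS.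
  by move: nz; rewrite zW /= => /exists_inPn; apply.
have W'W0 : W' \subset W0 :\: T by apply: subset_trans W'W (subsetDl _ _).
have I1W'D : {in I1 & W', forall y z, (y != z) && ~~ adj y z}.
  move=> y z yI zW; rewrite I1W' // andbT; apply/eqP => yz.
  by have := subsetP W'W z zW; rewrite inE -yz yI.
have NfarD (J : {set G}) : J \subset W0 :\: T -> {in N & J, forall y z, (y != z) && ~~ adj y z}.
  move=> JW y z yN zJ; have [_ zS zadj] := farT z (subsetP JW z zJ).
  rewrite zadj ?(subsetP NS) // andbT; apply: contraNneq zS => <-.
  exact: (subsetP NS).
have TW0 : T \subset W0.
  by apply/subsetP => z; rewrite !inE => /orP[/(subsetP SW0)|/andP[]].
have cW0 : #|W0| = #|T| + #|W0 :\: T| by rewrite -(cardsID T W0) (setIidPr TW0).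
(* [I0], [N] and [J] are pairwise disjoint and nonadjacent, so their union is independent. *)
have bound (J : {set G}) : J \subset W0 :\: T -> independent J -> #|I0| + a + #|J| <= 26.
  move=> JW indJ; have [indNJ cNJ] := card_independentU indN indJ (NfarD J JW).
  have [|ind c] := card_independentU indI0 indNJ.
    move=> y z yI; case/setUP => [zN | zJ]; apply: I0W0 => //.
      by rewrite (subsetP SW0) // (subsetP NS).
    by have [] := farT z (subsetP JW z zJ).
  by rewrite -addnA -Na -cNJ -c; apply: leq_trans (card_independent ind) alphaG.
(* If no rest survives, n <= 2|I0| + t + 2|I1| with |I0| + |I1| <= 26 - a. *)
have [W'0 | [w wW']] := set_0Vmem W'.
  have := bound I1 I1W indI1; move: cW; rewrite W'0 cards0 => cW bI.
  by move: nG cW cW0 Tt t68 bI; clear; lia.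
have b0 : 0 < \sum_z b z.
  have /card_gt0P[y /(subsetP NS)] : 0 < #|N| by rewrite Na.
  by rewrite Sb => by0; rewrite (bigD1 y) //= ltn_addr.
have W'0 : 0 < #|W'| by apply/card_gt0P; exists w.
have bW' : {in W', forall z, b z = 0}.
  move=> z /(subsetP W'W0)/farT[_ zS _]; apply/eqP.
  by rewrite -leqn0 leqNgt -Sb.
have adjbW' y z : 0 < b y -> z \in W' -> ~~ adj y z.
  by rewrite -Sb => yS /(subsetP W'W0)/farT[_ _]; apply.
have [/eqb[eqS eqT] reg grad] := balanced_degenerate lamG bW' adjbW' leb degW' W'0 b0.
have [I2 [I2W' indI2 cI2]] : exists J : {set G}, [/\ J \subset W', independent J & 2 * #|W'| <= 5 * #|J|].
  by apply: independent_maxdeg2 => // z /reg ->.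
have [indI12 cI12] : independent (I1 :|: I2) /\ #|I1 :|: I2| = #|I1| + #|I2|.
  by apply: card_independentU => // y z yI /(subsetP I2W'); exact: I1W'D.
have := bound (I1 :|: I2); rewrite subUset I1W (subset_trans I2W') // cI12 => /(_ isT indI12) bI.
(* If [T] equals [S], then n <= |S| + (5/2)(26 - a). Otherwise, with s the total of [b], the balance
   at a vertex [z] of [T] outside [S] gives |W'| <= s (a - 1), whence 5n <= 5t + 10 (26 - a) + s (a
   - 1). *)
have [TS | [z]] := set_0Vmem (T :\: S).
  have TleS : #|T| <= #|S| by apply: subset_leq_card; rewrite -setD_eq0 TS.
  by move: nG cW cW0 TleS eqS bI cI2; clear; lia.
rewrite inE => /andP[zS zT].
have zW' : z \notin W' by apply/negP => /(subsetP W'W0); rewrite inE zT.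
have bz : b z = 0 by apply/eqP; rewrite -leqn0 leqNgt -Sb.
have [y yS yz] : exists2 y, y \in S & adj y z.
  by move: zT; rewrite !inE (negbTE zS) => /andP[_ /exists_inP].
have gradz := grad z bz zW'.
have adjz : 0 < adj_sum b z.
  by rewrite /adj_sum (bigD1 y) //= adj_sym yz mul1n ltn_addr // -Sb.
(* Among the at most [a] neighbours of [z] in [W0], the vertex [y] lies in [S], hence not in
   [W']. *)
have degz : #|nbhd z :&: W'| <= a.-1.
  have zW0 := subsetP TW0 z zT; have := degW0 z zW0.
  rewrite (cardsD1 y) !inE adj_sym yz (subsetP SW0) // add1n => le_a.
  rewrite -ltnS (ltn_predK a0) ; apply: leq_trans le_a; rewrite ltnS.
  apply: subset_leq_card; apply/subsetP => u; rewrite !inE => /andP[zu uW'].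
  have [uW0 uS _] := farT u (subsetP W'W0 u uW').
  by rewrite zu uW0 !andbT; apply: contraNneq uS => ->.
have lew : #|W'| <= (\sum_z b z) * a.-1.
  apply: leq_trans (_ : (\sum_z b z) * #|nbhd z :&: W'| <= _); last by rewrite leq_mul2l degz orbT.
  by rewrite -gradz leq_pmulr.
by move: nG cW cW0 Tt eqT bI cI2 lew; clear; lia.
Qed.

End Core.

(** * Weights around a branching vertex *)

Section BranchWeight.
Variable G : sgraph.
Implicit Types (x y z : G) (W : {set G}).
Hypothesis tfG : triangle_free G.
Local Open Scope nat_scope.

Variables (x : G) (W : {set G}) (zeta : G -> G) (p q c : nat).
Let N := nbhd x :&: W.
Let a := #|N|.

(* For [(p, q, c) = (2, 1, 0)] with [a = 4], and [(3, 2, 1)] with [a = 3], these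
   are the null vectors of the affine Dynkin diagrams D4 and E6. *)
Definition branch_weight z :=
  p * (z == x) + \sum_(y in nbhd x :&: W) (q * (z == y) + c * (z == zeta y)).

Local Notation b := branch_weight.

Hypotheses (xW : x \in W) (p0 : 0 < p) (q0 : 0 < q).
Hypothesis zetaP : {in N, forall y, [&& adj y (zeta y), zeta y \in W & zeta y != x]}.

Lemma sum_branch_weight (F : G -> nat) :
  \sum_z b z * F z = p * F x + \sum_(y in N) (q * F y + c * F (zeta y)).
Proof.
have sum1 u : \sum_z (z == u) * F z = F u.
  by rewrite (bigD1 u) //= eqxx mul1n big1 ?addn0 // => z /negbTE->.
under eq_bigr do rewrite /branch_weight mulnDl -mulnA big_distrl /=.
rewrite big_split /= -big_distrr /= sum1; congr (_ + _).
rewrite exchange_big; apply: eq_bigr => y _ /=.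
under eq_bigr do rewrite mulnDl -!mulnA.
by rewrite big_split /= -!big_distrr /= !sum1.
Qed.

Lemma branch_weight_total : \sum_z b z = p + a * (q + c).
Proof.
transitivity (\sum_z b z * 1); first by apply: eq_bigr => z; rewrite muln1.
by rewrite sum_branch_weight !muln1 sum_nat_const.
Qed.

Lemma adj_sum_branch_weight z :
  adj_sum b z = p * adj z x + \sum_(y in N) (q * adj z y + c * adj z (zeta y)).
Proof. by rewrite -sum_branch_weight; apply: eq_bigr => y _; rewrite mulnC. Qed.

Let NP y : y \in N -> adj x y.
Proof. by rewrite !inE => /andP[]. Qed.

Let zeta_adj y : y \in N -> adj y (zeta y).
Proof. by move/zetaP/and3P=> []. Qed.

Let zeta_nadj y : y \in N -> adj x (zeta y) = false.
Proof.
by move=> yN; rewrite (@nbhd_nonadj _ tfG y) ?zeta_adj // adj_sym NP.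
Qed.

Let zeta_notin y y' : y \in N -> y' \in N -> (y == zeta y') = false.
Proof. by move=> /NP xy /zeta_nadj; case: eqP => // <-; rewrite xy. Qed.

Let sum_eq y : y \in N -> \sum_(y' in N) (y == y' :> G) = 1.
Proof.
move=> yN; rewrite (bigD1 y) //= eqxx big1 // => y' /andP[_ /negbTE].
by rewrite eq_sym => ->.
Qed.

(** The ends [zeta y] may coincide or have several neighbours in [N]: [e] counts the pairs with
    equal ends, [d] those where the end of one is adjacent to the other. Equal ends give such an
    adjacency, so coincidences never outweigh the extra edges. *)
Lemma branch_weight_form : exists e d, [/\ e <= d, a <= d,
  \sum_z b z * b z = p ^ 2 + a * q ^ 2 + c ^ 2 * e &
  2 * (a * p * q) + 2 * (q * c) * d <= \sum_z b z * adj_sum b z].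
Proof.
pose e y := \sum_(y' in N) (zeta y == zeta y').
pose f y := \sum_(y' in N) adj (zeta y) y'.
have bx : b x = p.
  rewrite /branch_weight eqxx muln1 big1 ?addn0 // => y yN.
  have /and3P[_ _ zx] := zetaP yN; rewrite eq_sym in zx.
  rewrite (negbTE zx); case: eqP => [xy|_]; last by rewrite !muln0.
  by have := NP yN; rewrite -xy adj_irr.
have bN y : y \in N -> b y = q.
  move=> yN; rewrite /branch_weight; case: eqP => [yx|_].
    by have := NP yN; rewrite yx adj_irr.
  rewrite muln0 add0n big_split /= -!big_distrr /= sum_eq // muln1.
  by rewrite big1 ?muln0 ?addn0 // => y' y'N; rewrite zeta_notin.
have bz y : y \in N -> b (zeta y) = c * e y.
  move=> yN; have /and3P[_ _ /negbTE zx] := zetaP yN.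
  rewrite /branch_weight zx muln0 add0n big_split /= -!big_distrr /=.
  by rewrite big1 ?muln0 ?add0n // => y' y'N; rewrite eq_sym zeta_notin.
have Ax : adj_sum b x = a * q.
  rewrite adj_sum_branch_weight adj_irr muln0 add0n.
  rewrite (eq_bigr (fun=> q)); first by rewrite sum_nat_const.
  by move=> y yN; rewrite NP // zeta_nadj // muln1 muln0 addn0.
have AN y : y \in N -> adj_sum b y = p + c * \sum_(y' in N) adj y (zeta y').
  move=> yN; rewrite adj_sum_branch_weight adj_sym NP // muln1; congr (_ + _).
  rewrite big_split /= -!big_distrr /= [X in q * X]big1 ?muln0 //.
  by move=> y' y'N; rewrite (nbhd_nonadj tfG (NP yN) (NP y'N)).
(* Only a lower bound, because edges between two ends are dropped. *)
have Az y : y \in N -> q * f y <= adj_sum b (zeta y).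
  move=> yN; rewrite adj_sum_branch_weight big_split /= -!big_distrr /=.
  by apply: leq_trans (leq_addl _ _); exact: leq_addr.
exists (\sum_(y in N) e y), (\sum_(y in N) f y); split.
- apply: leq_sum => y yN; apply: leq_sum => y' y'N.
  by case: eqP => // ->; rewrite adj_sym zeta_adj.
- rewrite /a -sum1_card; apply: leq_sum => y yN.
  by rewrite /f (bigD1 y) //= adj_sym zeta_adj.
- rewrite sum_branch_weight bx -mulnn -addnA; congr (_ + _).
  rewrite (eq_bigr (fun y => q * q + c ^ 2 * e y)); last first.
    by move=> y yN; rewrite bN // bz // mulnA mulnn.
  by rewrite big_split /= sum_nat_const -big_distrr /= mulnn.
- rewrite sum_branch_weight Ax.
  apply: leq_trans (_ : p * (a * q) + \sum_(y in N) (q * (p + c * \sum_(y' in N) adj y (zeta y')) + c * (q * f y)) <= _).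
    rewrite [X in _ <= _ + X](eq_bigr (fun y => q * p + q * c * (\sum_(y' in N) adj y (zeta y')) + q * c * f y)); last first.
      by move=> y _; rewrite mulnDr !mulnA [c * q]mulnC.
    rewrite !big_split /= sum_nat_const -/a -!big_distrr /=.
    have -> : \sum_(y in N) \sum_(y' in N) adj y (zeta y') = \sum_(y in N) f y.
      rewrite exchange_big; apply: eq_bigr => y _; apply: eq_bigr => y' _.
      by rewrite adj_sym.
    by rewrite leq_eqVlt; apply/orP; left; apply/eqP; ring.
  rewrite leq_add2l; apply: leq_sum => y yN.
  by rewrite AN // leq_add2l leq_mul2l Az ?orbT.
Qed.

Let S := [set z | 0 < b z].

Lemma branch_support z : z \in S ->
  [|| z == x, z \in N | (0 < c) && (z \in zeta @: N)].
Proof.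
rewrite inE; have [//|/negbTE zx] := eqVneq z x; case: (boolP (z \in N)) => //= zN bz.
have c0 : 0 < c.
  rewrite lt0n; apply: contraL bz => /eqP c0; rewrite -leqNgt leqn0.
  rewrite /branch_weight c0 zx muln0 add0n big1 // => y yN.
  by case: eqP => [zy|_]; rewrite ?muln0 //; move: zN; rewrite zy yN.
rewrite c0 /=; apply: contraLR bz => zz; rewrite -leqNgt leqn0 /branch_weight zx.
rewrite muln0 add0n big1 // => y yN.
case: eqP => [zy|_]; first by move: zN; rewrite zy yN.
case: eqP => [zy|_]; last by rewrite !muln0.
by case/negP: zz; rewrite zy imset_f.
Qed.

Lemma branch_N_support : N \subset S.
Proof.
apply/subsetP => y yN; rewrite inE /branch_weight (bigD1 y) //= eqxx muln1.
by move: q0; clear; lia.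
Qed.

Lemma branch_support_sub : S \subset W.
Proof.
apply/subsetP => z /branch_support/or3P[/eqP->//||/andP[_ /imsetP[y yN ->]]].
  by rewrite inE => /andP[].
by have /and3P[] := zetaP yN.
Qed.

Lemma card_branch_support : #|S| <= 1 + a * (1 + (0 < c)).
Proof.
apply: leq_trans (_ : #|x |: (N :|: (if 0 < c then zeta @: N else set0))| <= _).
  apply: subset_leq_card; apply/subsetP => z /branch_support.
  by rewrite !in_setU in_set1; case: (0 < c); rewrite ?in_set0.
rewrite cardsU1; apply: leq_add; first by case: (_ \notin _).
apply: leq_trans (leq_card_setU _ _) _; rewrite mulnDr muln1 leq_add2l.
by case: (0 < c); rewrite ?cards0 ?muln1 ?leq_imset_card.
Qed.

Hypothesis degW : {in W, forall z, #|nbhd z :&: W| <= a}.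

(** Besides [x] and [N], each vertex of [N] has at most a - 1 neighbours other than [x], its end
    among them, and each end, if weighted, at most a - 1 others. *)
Lemma card_branch_nbhd :
  #|S :|: [set z in W | [exists y in S, adj y z]]| <= 1 + a + a * a.-1 * (1 + (0 < c)).
Proof.
pose U1 := \bigcup_(y in N) ((nbhd y :&: W) :\ x).
pose U2 := if 0 < c then \bigcup_(y in N) ((nbhd (zeta y) :&: W) :\ y) else set0.
have cardD u v : u \in W -> v \in W -> adj u v -> #|(nbhd u :&: W) :\ v| <= a.-1.
  move=> uW vW uv; have := degW uW; rewrite (cardsD1 v) !inE uv vW add1n.
  by case: (a).
apply: leq_trans (_ : #|(x |: N) :|: (U1 :|: U2)| <= _).
  have zU1 y : y \in N -> zeta y \in U1.
    move=> yN; apply/bigcupP; exists y => //; have /and3P[yz zW zx] := zetaP yN.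
    by rewrite !inE zx yz zW.
  apply: subset_leq_card; apply/subsetP => z; rewrite in_setU => /orP[].
    case/branch_support/or3P => [/eqP->|zN|/andP[_ /imsetP[y yN ->]]].
    - by rewrite !inE eqxx.
    - by rewrite in_setU in_setU1 zN orbT.
    - by rewrite in_setU [_ \in _ :|: U2]in_setU zU1 ?orbT.
  rewrite inE => /andP[zW /exists_inP[y /branch_support yS yz]].
  case/or3P: yS => [/eqP yx|yN|/andP[c0 /imsetP[u uN yE]]].
  - by rewrite in_setU in_setU1 !inE -yx yz zW orbT.
  - have [->|zx] := eqVneq z x; first by rewrite !inE eqxx.
    rewrite in_setU; apply/orP; right; rewrite in_setU; apply/orP; left.
    by apply/bigcupP; exists y => //; rewrite !inE zx yz.
  - have [->|zu] := eqVneq z u; first by rewrite in_setU in_setU1 uN orbT.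
    rewrite in_setU; apply/orP; right; rewrite in_setU /U2 c0; apply/orP; right.
    by apply/bigcupP; exists u => //; rewrite !inE zu -yE yz.
apply: leq_trans (leq_card_setU _ _) _; apply: leq_add.
  by rewrite cardsU1 leq_add2r; case: (_ \notin _).
apply: leq_trans (leq_card_setU _ _) _; rewrite mulnDr muln1; apply: leq_add.
  apply: leq_card_bigcup => y yN; apply: cardD => //; last by rewrite adj_sym NP.
  by move: yN; rewrite inE => /andP[].
rewrite /U2; case: (0 < c); rewrite ?cards0 // muln1.
apply: leq_card_bigcup => y yN; have /and3P[yz zW _] := zetaP yN.
by apply: cardD; rewrite // 1?adj_sym //; move: yN; rewrite inE => /andP[].
Qed.

End BranchWeight.

(** * Maximum valency at most 5 *)

Section CardinalBounds.
Variables (R : realType) (G : sgraph).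
Implicit Types (x y z : G).
Hypothesis tfG : triangle_free G.
Hypothesis lamG : -5 <= lambda_min (seidel R (disjoint_union G two_K2)).
Hypothesis alphaG : (independence_number G <= 26)%N.
Local Open Scope nat_scope.

Lemma card_valency_le5 : (forall z, valency z <= 5) -> #|G| <= 68.
Proof.
move=> max5; have [I0 [W [[_ WI0 indI0] I0W degW cG]]] := peel [set: G].
rewrite cardsT in cG.
have I0WD : {in I0 & W, forall y z, (y != z) && ~~ adj y z}.
  move=> y z yI zW; rewrite I0W // andbT; apply/eqP => yz.
  by have := subsetP WI0 z zW; rewrite inE -yz yI.
(* If the rest has maximum degree two, n <= 2|I0| + (5/2)|I| <= 65. *)
have [/forall_inP deg2 | ] := boolP [forall z in W, #|nbhd z :&: W| <= 2].
  have [I [IW indI cI]] := independent_maxdeg2 tfG deg2.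
  have [|ind c] := card_independentU indI0 indI.
    by move=> y z yI /(subsetP IW); exact: I0WD.
  have := leq_trans (card_independent ind) alphaG.
  by move: cG c cI; clear; lia.
case/forall_inPn => x0 x0W; rewrite -ltnNge => deg3.
pose x := [arg max_(z > x0 in W) #|nbhd z :&: W|].
have [xW xmax] : x \in W /\ {in W, forall z, #|nbhd z :&: W| <= #|nbhd x :&: W|}.
  by rewrite /x; case: arg_maxnP => // x' x'W xm; split.
set a := #|nbhd x :&: W| in xmax.
have a3 : 3 <= a := leq_trans deg3 (xmax x0 x0W).
have a5 : a <= 5 by apply: leq_trans (max5 x); rewrite subset_leq_card // subsetIl.
(* On the neighbours of [x] in [W] the default is never taken: they have a second neighbour in [W]
   after the peeling. *)
pose zeta y := odflt y [pick u | [&& adj y u, u \in W & u != x]].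
have zetaP : {in nbhd x :&: W, forall y, [&& adj y (zeta y), zeta y \in W & zeta y != x]}.
  move=> y; rewrite !inE /zeta => /andP[xy yW]; case: pickP => [//|none].
  have := degW y yW; rewrite (cardsD1 x) !inE adj_sym xy xW ltnS => /card_gt0P[u].
  rewrite !inE => /and3P[ux yu uW].
  by have := none u; rewrite yu uW ux.
pose t c := 1 + a + a * a.-1 * (1 + (0 < c)).
have key p q c : 0 < p -> 0 < q -> t c + 2 * (26 - a) <= 68 ->
    (forall e d, e <= d -> a <= d ->
      2 * (p ^ 2 + a * q ^ 2 + c ^ 2 * e) <= 2 * (a * p * q) + 2 * (q * c) * d) ->
    (forall e d, e <= d -> a <= d ->
      2 * (p ^ 2 + a * q ^ 2 + c ^ 2 * e) < 2 * (a * p * q) + 2 * (q * c) * d) \/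
    2 * (1 + a * (1 + (0 < c))) + 5 * (26 - a) <= 137 /\
      5 * t c + 10 * (26 - a) + (p + a * (q + c)) * a.-1 <= 344 ->
    #|G| <= 68.
  move=> p0 q0 t68 le_form eq_form; pose b := branch_weight x W zeta p q c.
  have [e [d [ed ad bb bAb]]] := branch_weight_form tfG p q c zetaP.
  apply: (@core_bound R G tfG lamG alphaG I0 W (nbhd x :&: W) [set z | 0 < b z] b a (t c)) => //.
  - exact: independent_nbhdI.
  - by apply: leq_trans a3.
  - exact: branch_N_support.
  - exact: branch_support_sub zetaP.
  - by move=> z; rewrite inE.
  - by rewrite bb; apply: leq_trans bAb; exact: le_form.
  - exact: card_branch_nbhd xmax.
  - rewrite bb => E; case: eq_form => [/(_ e d ed ad)|[nS nT]].
      by rewrite E ltnNge bAb.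
    split; last by rewrite branch_weight_total.
    apply: leq_trans nS; rewrite leq_add2r leq_mul2l /=.
    exact: card_branch_support.
have : [\/ a = 3, a = 4 | a = 5].
  by move: a3 a5; clear; case: (a) => [|[|[|[|[|[|n]]]]]] // _ _;
    [constructor 1 | constructor 2 | constructor 3].
(* Affine E6 weights serve [a = 3] and affine D4 weights [a = 4], where equality may hold. For
   [a = 5] the D4 weights give 18 < 20, which excludes equality. *)
rewrite /t in key; case=> aE; rewrite aE in key.
- apply: (key 3 2 1) => // [e d|]; last by right.
  by clear; rewrite /=; lia.
- by apply: (key 2 1 0) => //; right.
- by apply: (key 2 1 0) => //; left.
Qed.

End CardinalBounds.



(** * Combining the bounds according to the maximum valency *)

Theorem theorem8p2 (R : realType) (G : sgraph)
    (tfG : triangle_free G)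
    (lamG : -5 <= lambda_min (seidel R (disjoint_union G two_K2)))
    (alphaG : (independence_number G <= 26)%N) :
  (#|G| <= 68)%N /\
  ((66 <= #|G|)%N ->
   exists x y : G, adj x y /\ (valency x + valency y <= 20)%N).
Proof.
have [n65 | n66] := leqP #|G| 65.
  by split=> //; exact: leq_trans n65 _.
have /card_gt0P[x0 _] : (0 < #|G|)%N by exact: leq_trans n66.
pose x := [arg max_(z > x0) valency z].
have xmax (z : G) : (valency z <= valency x)%N.
  by rewrite /x; case: arg_maxnP => // x' _ max_x'; exact: max_x'.
have x13 := valency_le13 tfG lamG x.
(* With at least 66 vertices, valencies 11 and 12 contradict the bound 65, and valency 13 allows
   only 66, which is excluded. *)
have x10 : (valency x <= 10)%N.
  rewrite leqNgt; apply/negP => x11.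
  have [xE | x13E] : (valency x = 11 \/ valency x = 12)%N \/ valency x = 13%N by lia.
    case: xE => xE; rewrite xE in xmax.
      by have := card_valency11 tfG lamG xE xmax; lia.
    by have := card_valency12 tfG lamG xE xmax; lia.
  have := valency13_card tfG lamG x13E; have := valency13_card_ne66 tfG lamG x13E.
  by lia.
split.
  have [x5 | x6] := leqP (valency x) 5.
    apply: (card_valency_le5 tfG lamG alphaG) => z.
    exact: leq_trans (xmax z) x5.
  have : (valency x = 6 \/ valency x = 7 \/ valency x = 8 \/ valency x = 9 \/
    valency x = 10)%N by lia.
  case=> [|[|[|[|]]]] xE; rewrite xE in xmax.
  - exact: (card_valency6 tfG lamG xE xmax).
  - exact: (card_valency7 tfG lamG xE xmax).
  - exact: (card_valency8 tfG lamG xE xmax).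
  - exact: (card_valency9 tfG lamG xE xmax).
  - exact: (card_valency10 tfG lamG xE xmax).
(* Any edge will do, since all valencies are at most 10; without edges all of [G], at least 66
   vertices, would be independent. *)
move=> _; have [/existsP[y /existsP[z yz]] | noedge] := boolP [exists y : G, [exists z, adj y z]].
  by exists y, z; split=> //; have := xmax y; have := xmax z; lia.
have : independent [set: G].
  apply/independentP => y z _ _; apply/negP => yz; case/negP: noedge.
  by apply/existsP; exists y; apply/existsP; exists z.
by move/card_independent; rewrite cardsT => le_alpha; have := leq_trans le_alpha alphaG; lia.
Qed.
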